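(* Let $\varphi$ be a formula. (1) If $\varphi$ does not contain $ite$, then $|\mathcal R^*(\varphi)|=O(|\varphi|)$, i.e. the size of the rewritten formula is linear in the size of $\varphi$. (2) If $\varphi$ contains $ite$, the size of $\mathcal R^*(\varphi)$ is, in the worst case, exponentially larger than $\varphi$.
   Context: Formulas and terms over a first-order signature: $\varphi::=\top\mid\bot\mid p(u_1,\dots,u_n)\mid\neg\varphi\mid\varphi\vee\varphi\mid X\varphi\mid\varphi U\varphi\mid Y\varphi\mid\varphi S\varphi$; $u::=c\mid x\mid f(u_1,\dots,u_n)\mid next(u)\mid ite(\varphi,u,u)\mid u@\tilde F\varphi\mid u@\tilde P\varphi$ ($c,f,p$ constant, function and predicate symbols, $x$ a variable; Boolean variables are used as atomic formulas). $|\cdot|$ denotes the size (number of symbol occurrences) of a formula or term. Abbreviations: $\wedge$ as usual, $\varphi R\psi:=\neg(\neg\varphi U\neg\psi)$, $Z\varphi:=\neg Y\neg\varphi$. The variables are partitioned into inputs and outputs; an atomic formula is an input predicate ($Pred^I$) if one of its arguments contains an input variable or a subterm $next(\cdot)$ or $\cdot@\tilde F\cdot$, and an output predicate ($Pred^O$) otherwise. Let $run,end$ be fixed Boolean variables and $state:=run\vee(Z\,run\wedge end)$. For $sgn\in\{-,+\}$ the rewriting $\mathcal R^{sgn}$ is: $\mathcal R^-(Pred^I(u_1,\dots,u_n)):=\neg run\vee Pred^I(\mathcal R^-(u_1),\dots,\mathcal R^-(u_n))$; $\mathcal R^+(Pred^I(\bar u)):=run\wedge Pred^I(\mathcal R^+(u_1),\dots)$;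 $\mathcal R^{sgn}(Pred^O(\bar u)):=Pred^O(\mathcal R^{sgn}(u_1),\dots)$; $\mathcal R^{sgn}(\varphi_1\vee\varphi_2):=\mathcal R^{sgn}(\varphi_1)\vee\mathcal R^{sgn}(\varphi_2)$; $\mathcal R^-(\neg\varphi):=\neg\mathcal R^+(\varphi)$, $\mathcal R^+(\neg\varphi):=\neg\mathcal R^-(\varphi)$; $\mathcal R^-(X\varphi):=X(state\,R\,(\neg state\vee\mathcal R^-(\varphi)))$; $\mathcal R^+(X\varphi):=X(\neg state\,U\,(state\wedge\mathcal R^+(\varphi)))$; $\mathcal R^-(\varphi_1U\varphi_2):=(\neg state\vee\mathcal R^-(\varphi_1))\,U\,((state\wedge\mathcal R^-(\varphi_2))\vee Y\,end)$; $\mathcal R^+(\varphi_1U\varphi_2):=(\neg state\vee\mathcal R^+(\varphi_1))\,U\,(state\wedge\mathcal R^+(\varphi_2))$; $\mathcal R^{sgn}(Y\varphi):=Y(\neg run\,S\,(run\wedge\mathcal R^{sgn}(\varphi)))$; $\mathcal R^{sgn}(\varphi_1S\varphi_2):=(\neg state\vee\mathcal R^{sgn}(\varphi_1))\,S\,(state\wedge\mathcal R^{sgn}(\varphi_2))$; $\mathcal R^{sgn}(x):=x$, $\mathcal R^{sgn}(c):=c$, $\mathcal R^{sgn}(f(\bar u)):=f(\mathcal R^{sgn}(u_1),\dots)$, $\mathcal R^{sgn}(ite(\varphi,u_1,u_2)):=ite(\mathcal R^+(\varphi),\mathcal R^-(u_1),ite(\mathcal R^+(\neg\varphi),\mathcal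 R^-(u_2),def_{ite(\varphi,u_1,u_2)}))$ (with $def_{\dots}$ a fresh symbol), $\mathcal R^{sgn}(next(u)):=\mathcal R^{sgn}(u)@\tilde F(state)$, $\mathcal R^{sgn}(u@\tilde F\varphi):=\mathcal R^{sgn}(u)@\tilde F(state\wedge\mathcal R^+(\varphi))$, $\mathcal R^{sgn}(u@\tilde P\varphi):=\mathcal R^{sgn}(u)@\tilde P(state\wedge\mathcal R^+(\varphi))$. $\mathcal R(\varphi):=\mathcal R^-(\varphi)$ and $\mathcal R^*(\varphi):=state\,R\,(\neg state\vee\mathcal R(\varphi))$. *)

(* Defs.v *)
From HB Require Import structures.
From mathcomp Require Import all_boot.

Set Implicit Arguments.
Unset Strict Implicit.
Unset Printing Implicit Defensive.

Record signature := Signature {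
  const : Type;
  func : Type;
  pred_sym : Type;
  var : Type;
  func_arity : func -> nat;
  pred_arity : pred_sym -> nat;
  is_bool : var -> bool;
  is_input : var -> bool;  (* the other variables are the outputs *)
  run_var : {x : var | is_bool x};
  end_var : {x : var | is_bool x}
}.

Definition bvar (S : signature) : Type := {x : var S | is_bool x}.

(* An argument list of length n is a function on 'I_n. *)
Inductive formula (S : signature) : Type :=
| FTop
| FBot
| FBool of bvar S
| FPred (p : pred_sym S) of ('I_(pred_arity p) -> term S)
| FNot of formula S
| FOr of formula S & formula S
| FX of formula S
| FU of formula S & formula S
| FY of formula S
| FS of formula S & formula S
with term (S : signature) : Type :=
| TConst of const S
| TVar of var S
| TFunc (f : func S) of ('I_(func_arity f) -> term S)
| TNext of term S
| TIte of formula S & term S & term S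
| TAtF of term S & formula S
| TAtP of term S & formula S.

Arguments FTop {S}.
Arguments FBot {S}.
Arguments FBool {S} _.
Arguments FPred {S} p _.
Arguments TConst {S} _.
Arguments TVar {S} _.
Arguments TFunc {S} f _.

Definition FAnd (S : signature) (phi psi : formula S) : formula S :=
  FNot (FOr (FNot phi) (FNot psi)).

Definition FR (S : signature) (phi psi : formula S) : formula S :=
  FNot (FU (FNot phi) (FNot psi)).

Definition FZ (S : signature) (phi : formula S) : formula S :=
  FNot (FY (FNot phi)).

Fixpoint fsize (S : signature) (phi : formula S) : nat :=
  match phi with
  | FTop | FBot | FBool _ => 1
  | FPred p us => 1 + \sum_(i < pred_arity p) tsize (us i)
  | FNot a | FX a | FY a => 1 + fsize a
  | FOr a b | FU a b | FS a b => 1 + fsize a + fsize b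
  end
with tsize (S : signature) (u : term S) : nat :=
  match u with
  | TConst _ | TVar _ => 1
  | TFunc f us => 1 + \sum_(i < func_arity f) tsize (us i)
  | TNext v => 1 + tsize v
  | TIte a v w => 1 + fsize a + tsize v + tsize w
  | TAtF v a | TAtP v a => 1 + tsize v + fsize a
  end.

Fixpoint f_has_ite (S : signature) (phi : formula S) : bool :=
  match phi with
  | FTop | FBot | FBool _ => false
  | FPred p us => [exists i : 'I_(pred_arity p), t_has_ite (us i)]
  | FNot a | FX a | FY a => f_has_ite a
  | FOr a b | FU a b | FS a b => f_has_ite a || f_has_ite b
  end
with t_has_ite (S : signature) (u : term S) : bool :=
  match u with
  | TConst _ | TVar _ => false
  | TFunc f us => [exists i : 'I_(func_arity f), t_has_ite (us i)]
  | TNext v => t_has_ite v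
  | TIte _ _ _ => true
  | TAtF v a | TAtP v a => t_has_ite v || f_has_ite a
  end.

(* Occurrence, at any depth (also inside the formulas nested in terms), of an
   input variable or of a subterm next(.) or .@~F. *)
Fixpoint f_input (S : signature) (phi : formula S) : bool :=
  match phi with
  | FTop | FBot => false
  | FBool x => is_input (sval x)
  | FPred p us => [exists i : 'I_(pred_arity p), t_input (us i)]
  | FNot a | FX a | FY a => f_input a
  | FOr a b | FU a b | FS a b => f_input a || f_input b
  end
with t_input (S : signature) (u : term S) : bool :=
  match u with
  | TConst _ => false
  | TVar x => is_input x
  | TFunc f us => [exists i : 'I_(func_arity f), t_input (us i)]
  | TNext _ => true
  | TIte a v w => f_input a || t_input v || t_input w
  | TAtF _ _ => true
  | TAtP v a => t_input v || f_input a
  end.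

(* The signature of rewritten formulas: inr (phi, u1, u2) is the fresh symbol
   def_{ite(phi, u1, u2)}. *)
Definition def_sig (S : signature) : signature :=
  {| const := const S + (formula S * term S * term S);
     func := func S;
     pred_sym := pred_sym S;
     var := var S;
     func_arity := @func_arity S;
     pred_arity := @pred_arity S;
     is_bool := @is_bool S;
     is_input := @is_input S;
     run_var := run_var S;
     end_var := end_var S |}.

Definition Frun (S : signature) : formula S := FBool (run_var S).
Definition Fend (S : signature) : formula S := FBool (end_var S).
Arguments Frun {S}.
Arguments Fend {S}.

Definition Fstate (S : signature) : formula S :=
  FOr Frun (FAnd (FZ Frun) Fend).
Arguments Fstate {S}.

Inductive sign := Minus | Plus.

Definition opp (sgn : sign) : sign :=
  match sgn with Minus => Plus | Plus => Minus end.

Definition guard_input (S : signature) (sgn : sign) (inp : bool)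
    (phi : formula S) : formula S :=
  if inp then
    match sgn with
    | Minus => FOr (FNot Frun) phi
    | Plus => FAnd Frun phi
    end
  else phi.

(* A Boolean variable is an input predicate when it is itself an input. In the
   ite case, FNot (rwF Minus a) is the rewriting of FNot a with sign Plus. *)
Fixpoint rwF (S : signature) (sgn : sign) (phi : formula S) :
    formula (def_sig S) :=
  match phi with
  | FTop => FTop
  | FBot => FBot
  | FBool x =>
      guard_input sgn (f_input (FBool x)) (@FBool (def_sig S) x)
  | FPred p us =>
      guard_input sgn (f_input (FPred p us))
        (@FPred (def_sig S) p (fun i => rwT sgn (us i)))
  | FNot a => FNot (rwF (opp sgn) a)
  | FOr a b => FOr (rwF sgn a) (rwF sgn b)
  | FX a =>
      match sgn with
      | Minus => FX (FR Fstate (FOr (FNot Fstate) (rwF Minus a)))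
      | Plus => FX (FU (FNot Fstate) (FAnd Fstate (rwF Plus a)))
      end
  | FU a b =>
      match sgn with
      | Minus => FU (FOr (FNot Fstate) (rwF Minus a))
                    (FOr (FAnd Fstate (rwF Minus b)) (FY Fend))
      | Plus => FU (FOr (FNot Fstate) (rwF Plus a))
                   (FAnd Fstate (rwF Plus b))
      end
  | FY a => FY (FS (FNot Frun) (FAnd Frun (rwF sgn a)))
  | FS a b => FS (FOr (FNot Fstate) (rwF sgn a)) (FAnd Fstate (rwF sgn b))
  end
with rwT (S : signature) (sgn : sign) (u : term S) : term (def_sig S) :=
  match u with
  | TConst c => @TConst (def_sig S) (inl c)
  | TVar x => @TVar (def_sig S) x
  | TFunc f us => @TFunc (def_sig S) f (fun i => rwT sgn (us i))
  | TNext v => TAtF (rwT sgn v) Fstate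
  | TIte a v w =>
      TIte (rwF Plus a) (rwT Minus v)
        (TIte (FNot (rwF Minus a)) (rwT Minus w)
           (@TConst (def_sig S) (inr (a, v, w))))
  | TAtF v a => TAtF (rwT sgn v) (FAnd Fstate (rwF Plus a))
  | TAtP v a => TAtP (rwT sgn v) (FAnd Fstate (rwF Plus a))
  end.

Definition rw (S : signature) (phi : formula S) : formula (def_sig S) :=
  rwF Minus phi.

Definition rw_star (S : signature) (phi : formula S) : formula (def_sig S) :=
  FR Fstate (FOr (FNot Fstate) (rw phi)).

(* Main.v *)
From mathcomp Require Import all_boot zify.
Require Import Defs.

(** Apart from a bounded number of symbols added at each node, the rewriting
    copies every immediate subexpression once, except that it copies the
    condition of an [ite] twice, once with each sign.  So, up to a constant
    factor, the rewriting of [phi] has the size of [phi] with every condition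
    counted twice.  Without [ite] this is the size of [phi].  In general it is
    less than [2 ^ fsize phi], and nesting conditions, as in
    [phi |-> p(.., ite(phi, u, u), ..)], doubles it at a constant cost in
    size. *)

Set Implicit Arguments.
Unset Strict Implicit.
Unset Printing Implicit Defensive.

Scheme formula_term_ind := Induction for formula Sort Prop
with term_formula_ind := Induction for term Sort Prop.
Combined Scheme formula_term_mutind from formula_term_ind, term_formula_ind.

Fixpoint f_dup_size (S : signature) (phi : formula S) : nat :=
  match phi with
  | FTop | FBot | FBool _ => 1
  | FPred p us => 1 + \sum_(i < pred_arity p) t_dup_size (us i)
  | FNot a | FX a | FY a => 1 + f_dup_size a
  | FOr a b | FU a b | FS a b => 1 + f_dup_size a + f_dup_size b
  end
with t_dup_size (S : signature) (u : term S) : nat :=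
  match u with
  | TConst _ | TVar _ => 1
  | TFunc f us => 1 + \sum_(i < func_arity f) t_dup_size (us i)
  | TNext v => 1 + t_dup_size v
  | TIte a v w => 1 + (f_dup_size a).*2 + t_dup_size v + t_dup_size w
  | TAtF v a | TAtP v a => 1 + t_dup_size v + f_dup_size a
  end.

Lemma f_dup_size_gt0 (S : signature) (phi : formula S) : 0 < f_dup_size phi.
Proof. by case: phi. Qed.

Lemma fsize_gt0 (S : signature) (phi : formula S) : 0 < fsize phi.
Proof. by case: phi. Qed.

Lemma dup_size_no_ite (S : signature) :
  (forall phi : formula S, ~~ f_has_ite phi -> f_dup_size phi = fsize phi) /\
  (forall u : term S, ~~ t_has_ite u -> t_dup_size u = tsize u).
Proof.
have args_eq n (us : 'I_n -> term S) :
    (forall i, ~~ t_has_ite (us i) -> t_dup_size (us i) = tsize (us i)) ->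
    ~~ [exists i, t_has_ite (us i)] ->
    \sum_(i < n) t_dup_size (us i) = \sum_(i < n) tsize (us i).
  by move=> IH /existsPn us_ite; apply: eq_bigr => i _; apply: IH.
apply: formula_term_mutind => //=.
- by move=> p us IH /(args_eq _ _ IH)->.
- by move=> a IH /IH->.
- by move=> a IHa b IHb /norP[/IHa-> /IHb->].
- by move=> a IH /IH->.
- by move=> a IHa b IHb /norP[/IHa-> /IHb->].
- by move=> a IH /IH->.
- by move=> a IHa b IHb /norP[/IHa-> /IHb->].
- by move=> f us IH /(args_eq _ _ IH)->.
- by move=> v IH /IH->.
- by move=> v IHv a IHa /norP[/IHv-> /IHa->].
- by move=> v IHv a IHa /norP[/IHv-> /IHa->].
Qed.

Lemma ltn_add_exp2 (x y m n : nat) :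
  x < 2 ^ m -> y < 2 ^ n -> x + y < 2 ^ (m + n).
Proof. by rewrite expnD; nia. Qed.

Lemma ltn_sum_exp2 (I : Type) (r : seq I) (P : pred I) (F G : I -> nat) :
  (forall i, P i -> F i < 2 ^ G i) ->
  \sum_(i <- r | P i) F i < 2 ^ (\sum_(i <- r | P i) G i).
Proof. by move=> ltFG; elim/big_ind2: _ => // *; apply: ltn_add_exp2. Qed.

Lemma dup_size_lt_exp2 (S : signature) :
  (forall phi : formula S, f_dup_size phi < 2 ^ fsize phi) /\
  (forall u : term S, t_dup_size u < 2 ^ tsize u).
Proof.
apply: formula_term_mutind => //=.
(* In all clauses but that of [ite], [f_dup_size] and [fsize] are the same sum
   over the immediate subexpressions. *)
all: try by move=> *; do ?apply: ltn_add_exp2 => //; apply: ltn_sum_exp2.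
move=> a IHa v IHv w IHw; do 2!apply: ltn_add_exp2 => //.
by rewrite expnS; lia.
Qed.

Lemma fsize_guard_input (S : signature) sgn inp (phi : formula S) :
  fsize phi <= fsize (guard_input sgn inp phi) <= 5 + fsize phi.
Proof. by case: inp sgn => -[] /=; lia. Qed.

Lemma fsize_rwF_FPred (S : signature) (p : pred_sym S)
    (us : 'I_(pred_arity p) -> term S) sgn :
  1 + \sum_(i < pred_arity p) tsize (rwT sgn (us i))
    <= fsize (rwF sgn (FPred p us))
    <= 6 + \sum_(i < pred_arity p) tsize (rwT sgn (us i)).
Proof. exact: (fsize_guard_input sgn _ (@FPred (def_sig S) p _)). Qed.

(* 32 is the number of symbols added at a [U] rewritten with sign [Minus], the
   largest overhead of all cases. *)
Lemma rw_size_bounds (S : signature) :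
  (forall (phi : formula S) sgn,
     f_dup_size phi <= fsize (rwF sgn phi) <= 32 * f_dup_size phi) /\
  (forall (u : term S) sgn,
     t_dup_size u <= tsize (rwT sgn u) <= 32 * t_dup_size u).
Proof.
have args_bounds n (us : 'I_n -> term S) :
    (forall i sgn, t_dup_size (us i) <= tsize (rwT sgn (us i))
                     <= 32 * t_dup_size (us i)) ->
    forall sgn, \sum_(i < n) t_dup_size (us i)
      <= \sum_(i < n) tsize (rwT sgn (us i))
      <= 32 * \sum_(i < n) t_dup_size (us i).
  move=> IH sgn; rewrite big_distrr /=.
  by apply/andP; split; apply: leq_sum => i _; case/andP: (IH i sgn).
apply: formula_term_mutind => //=.
- move=> x sgn.
  have := fsize_guard_input sgn (is_input (sval x)) (@FBool (def_sig S) x).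
  by rewrite /=; lia.
- move=> p us /args_bounds us_bounds sgn.
  by have := fsize_rwF_FPred us sgn; have := us_bounds sgn; rewrite /=; lia.
- by move=> a IH sgn; have := IH (opp sgn); lia.
- by move=> a IHa b IHb sgn; have := IHa sgn; have := IHb sgn; lia.
- by move=> a IH sgn; have := IH sgn; case: sgn => /=; lia.
- move=> a IHa b IHb sgn; have := IHa sgn; have := IHb sgn.
  by case: sgn => /=; lia.
- by move=> a IH sgn; have := IH sgn; lia.
- by move=> a IHa b IHb sgn; have := IHa sgn; have := IHb sgn; lia.
- move=> f us /args_bounds us_bounds sgn.
  have /andP[le_rw rw_le] := us_bounds sgn.
  by rewrite mulnDr leq_add2l leq_add // andbT.
- by move=> v IH sgn; have := IH sgn; lia.
- move=> a IHa v IHv w IHw _; have := IHa Minus; have := IHa Plus.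
  by have := IHv Minus; have := IHw Minus; lia.
- by move=> v IHv a IHa sgn; have := IHv sgn; have := IHa Plus; lia.
- by move=> v IHv a IHa sgn; have := IHv sgn; have := IHa Plus; lia.
Qed.

Lemma rw_star_size_bounds (S : signature) (phi : formula S) :
  f_dup_size phi <= fsize (rw_star phi) <= 60 * f_dup_size phi.
Proof.
have -> : fsize (rw_star phi) = 28 + fsize (rwF Minus phi).
  by rewrite /= /rw; lia.
by have := (rw_size_bounds S).1 phi Minus; have := f_dup_size_gt0 phi; lia.
Qed.

Section NestedIte.

Variables (S : signature) (p : pred_sym S).
Variables (us : 'I_(pred_arity p) -> term S) (i0 : 'I_(pred_arity p)).

Definition nest_ite (phi : formula S) : formula S :=
  FPred p (fun i => if i == i0 then TIte phi (us i) (us i) else us i).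

Definition nest_ite_cost : nat :=
  2 + tsize (us i0) + \sum_(i < pred_arity p) tsize (us i).

Lemma fsize_iter_nest_ite q phi :
  fsize (iter q nest_ite phi) = q * nest_ite_cost + fsize phi.
Proof.
elim: q => // q IHq; rewrite iterS mulSn -addnA -IHq /nest_ite_cost /=.
rewrite (bigD1 i0) //= eqxx [in RHS](bigD1 i0) //=.
under eq_bigr => i /negPf -> do [].
by lia.
Qed.

Lemma f_has_ite_iter_nest_ite q phi : 0 < q -> f_has_ite (iter q nest_ite phi).
Proof. by case: q => // q _; apply/existsP; exists i0; rewrite eqxx. Qed.

Lemma f_dup_size_iter_nest_ite q phi :
  2 ^ q * f_dup_size phi <= f_dup_size (iter q nest_ite phi).
Proof.
elim: q => [|q IHq]; first by rewrite mul1n.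
rewrite iterS /= (bigD1 i0) //= eqxx /= expnS -mulnA mul2n.
by move: IHq; rewrite -leq_double; lia.
Qed.

End NestedIte.

Lemma f_has_ite_FPred (S : signature) (phi : formula S) : f_has_ite phi ->
  exists (p : pred_sym S) us, f_has_ite (FPred p us).
Proof.
by elim: phi => //= [p us|a IHa b IHb|a IHa b IHb|a IHa b IHb];
  [exists p, us | case/orP..].
Qed.

Lemma fsize_iter_FNot (S : signature) r (phi : formula S) :
  fsize (iter r (@FNot S) phi) = r + fsize phi.
Proof. by elim: r => //= r ->. Qed.

Lemma exists_exponential_f_dup_size (S : signature) (psi : formula S) :
  f_has_ite psi ->
  exists2 d, 0 < d & forall n, d < n -> exists phi : formula S,
    [/\ f_has_ite phi, fsize phi = n & 2 ^ n <= f_dup_size phi ^ d].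
Proof.
move=> /f_has_ite_FPred[p [us /existsP[i0 _]]].
pose cost := nest_ite_cost us i0; have cost_gt0 : 0 < cost by [].
exists cost.*2 => [|n lt_n]; first by rewrite double_gt0.
pose depth := n.-1 %/ cost; pose padding := iter (n.-1 %% cost) (@FNot S) FTop.
have depth_gt0 : 0 < depth by rewrite divn_gt0 //; lia.
exists (iter depth (nest_ite us i0) padding); split.
- exact: f_has_ite_iter_nest_ite.
- by rewrite fsize_iter_nest_ite fsize_iter_FNot addnA -divn_eq addn1; lia.
- apply: (@leq_trans ((2 ^ depth) ^ cost.*2)).
    rewrite -expnM leq_exp2l // -doubleMr.
    by have := ltn_ceil n.-1 cost_gt0; rewrite -/depth; nia.
  rewrite leq_exp2r ?double_gt0 //.
  apply: leq_trans (f_dup_size_iter_nest_ite _ _ _ _).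
  by rewrite leq_pmulr // f_dup_size_gt0.
Qed.

Theorem theorem5p6 :
  (exists C : nat, forall (S : signature) (phi : formula S),
      ~~ f_has_ite phi -> fsize (rw_star phi) <= C * fsize phi)
  /\
  ((exists C : nat, forall (S : signature) (phi : formula S),
      f_has_ite phi -> fsize (rw_star phi) <= 2 ^ (C * fsize phi))
   /\
   (forall S : signature, (exists psi : formula S, f_has_ite psi) ->
      exists d n0 : nat, forall n : nat, n0 <= n ->
        exists phi : formula S,
          [/\ f_has_ite phi, fsize phi = n &
              2 ^ n <= fsize (rw_star phi) ^ d])).
Proof.
split; [|split].
- exists 60 => S phi no_ite; have /andP[_] := rw_star_size_bounds phi.
  by rewrite (dup_size_no_ite S).1.
- exists 7 => S phi _; have /andP[_ le_rw] := rw_star_size_bounds phi.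
  apply: (@leq_trans (2 ^ (6 + fsize phi))).
    by have := (dup_size_lt_exp2 S).1 phi; rewrite expnD; lia.
  by rewrite leq_exp2l //; have := fsize_gt0 phi; lia.
- move=> S [psi /exists_exponential_f_dup_size[d d_gt0 dup_large]].
  exists d, d.+1 => n /dup_large[phi [phi_ite phi_n le_dup]].
  exists phi; split=> //; apply: leq_trans le_dup _.
  by rewrite leq_exp2r //; case/andP: (rw_star_size_bounds phi).
Qed.
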